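(* For every integer $n\ge2$, $c_1(\mathrm{TC}(Gr_n))\ge5760^{-1}(n-1)$, where $Gr_n$ denotes $\{0,\dots,2^n\}^2$ with the $\ell_1$-metric.
   Context: For a finite metric space $(X,d)$, $\mathrm{TC}(X)$ is the space of signed measures $\mu$ on $X$ with $\mu(X)=0$ normed by $\|\mu\|_{\mathrm{TC}}=\inf\sum_ia_id(x_i,y_i)$ over representations $\mu=\sum_ia_i(\delta_{x_i}-\delta_{y_i})$, $a_i\ge0$. For a metric space $Y$, $c_1(Y)$ is the infimal $D\ge1$ such that some map $F$ of $Y$ into an $L_1$-space satisfies $\rho(x,y)\le\|F(x)-F(y)\|_1\le D\rho(x,y)$. *)

(* Defs.v *)
From HB Require Import structures.
From mathcomp Require Import all_boot all_order all_algebra.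
From mathcomp Require Import all_classical all_reals all_analysis.
Set Implicit Arguments. Unset Strict Implicit. Unset Printing Implicit Defensive.
Import Order.TTheory GRing.Theory Num.Theory.
Local Open Scope classical_set_scope.
Local Open Scope ring_scope.

(* Signed measures on a finite set X are functions X -> R. *)
Definition zero_mass (R : realType) (X : finType) (mu : X -> R) : Prop :=
  \sum_(x : X) mu x = 0.

(* Representations mu = sum_i a_i (delta_{x_i} - delta_{y_i}), a_i >= 0,
   encoded as finite sequences of triples (a_i, x_i, y_i). *)
Definition tc_reps (R : realType) (X : finType) (mu : X -> R) :
    set (seq (R * X * X)) :=
  [set s | all (fun t => 0 <= t.1.1) s /\
     forall z : X, mu z = \sum_(t <- s) t.1.1 * ((t.1.2 == z)%:R - (t.2 == z)%:R)].

Definition tc_norm (R : realType) (X : finType) (d : X -> X -> R) (mu : X -> R) : R :=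
  inf [set \sum_(t <- s) t.1.1 * d t.1.2 t.2 | s in tc_reps mu].

Definition grid (n : nat) : finType := ('I_(2 ^ n).+1 * 'I_(2 ^ n).+1)%type.

Definition l1dist (R : realType) (n : nat) (p q : grid n) : R :=
  `|(nat_of_ord p.1)%:R - (nat_of_ord q.1)%:R| +
  `|(nat_of_ord p.2)%:R - (nat_of_ord q.2)%:R|.

(* Main.v *)
Require Import Defs.
From HB Require Import structures.
From mathcomp Require Import all_boot all_order all_algebra.
From mathcomp Require Import all_classical all_reals all_analysis.
From mathcomp Require Import zify ring lra.
Import Order.TTheory GRing.Theory Num.Theory.
Local Open Scope classical_set_scope.
Local Open Scope ring_scope.

(**
  For a linear map into L_1 the bound reduces to an inequality between linear functionals.
  Cut the 2^n x 2^n square into dyadic blocks of side l and let mu_eps be the horizontal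
  Haar function of each block times an independent sign.  A tent function dual to mu_eps
  shows ||mu_eps||_TC >= 4^n l / 32.  On the other hand, for the indicator f of a set of
  perimeter P, the isoperimetric inequality in each block and orthogonality of the signs give
    E |<f, mu_eps>| <= min (sqrt (l^3 P), P^2),
  so that the sum over the scales l = 4^k of l^-1 E |<f, mu_eps>| is at most 6 P; by the
  coarea formula it is at most 6 times the total variation of f for every f.  Applied to
  the values of the L_1-embedding on Dirac masses this bounds the number of scales by a
  multiple of the distortion.

  A non-linear F is first averaged over long boxes in the directions delta_x, which makes
  its second differences small while keeping the upper Lipschitz bound; the discrete
  derivatives of the average are then almost linear.  Averaging the base point along
  segments in the directions mu_eps, much longer than these boxes, telescopes and recovers
  the lower Lipschitz bound for the derivative.
*)

(** * The real-valued $L_1$ seminorm *)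

Section L1Seminorm.
Context {R : realType} {disp : measure_display} {T : measurableType disp}.
Variable m : {measure set T -> \bar R}.

Definition integ (h : T -> R) : Prop := m.-integrable setT (EFin \o h).

(** The real integral sends an infinite value to 0, so this is the $L_1$ norm when [integ h] holds;
    [nrm1E] then links it to the extended-real integral. *)
Definition nrm1 (h : T -> R) : R := \int[m]_x `|h x|.

Lemma integ0 : integ (fun=> 0).
Proof. exact: integrable0. Qed.

Lemma integD g h : integ g -> integ h -> integ (fun t => g t + h t).
Proof. by move=> gi hi; have := integrableD measurableT gi hi. Qed.

Lemma integB g h : integ g -> integ h -> integ (fun t => g t - h t).
Proof. by move=> gi hi; have := integrableB measurableT gi hi. Qed.

Lemma integZ c h : integ h -> integ (fun t => c * h t).
Proof. by move=> hi; have := integrableZl measurableT c hi. Qed.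

Lemma integ_norm h : integ h -> integ (fun t => `|h t|).
Proof. exact: integrable_norm. Qed.

Lemma integ_sum (I : Type) (s : seq I) (h : I -> T -> R) :
  (forall i, integ (h i)) -> integ (fun t => \sum_(i <- s) h i t).
Proof.
move=> hi; elim: s => [|i s IHs].
  by under eq_fun do rewrite big_nil; exact: integ0.
under eq_fun do rewrite big_cons.
exact: integD.
Qed.

Lemma nrm1_ge0 h : 0 <= nrm1 h.
Proof. by apply: Rintegral_ge0 => t _. Qed.

Lemma nrm1_0 : nrm1 (fun=> 0) = 0.
Proof.
by rewrite /nrm1; under eq_Rintegral do rewrite normr0; rewrite /Rintegral integral0.
Qed.

Lemma nrm1E h : integ h -> (nrm1 h)%:E = (\int[m]_x (`|h x|)%:E)%E.
Proof.
by move=> hi; rewrite /nrm1 /Rintegral fineK//; apply: integrable_fin_num => //; exact: integ_norm.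
Qed.

Lemma sum_nrm1 (I : Type) (s : seq I) (c : I -> R) (h : I -> T -> R) :
  (forall i, integ (h i)) ->
  \int[m]_x (\sum_(i <- s) c i * `|h i x|) = \sum_(i <- s) c i * nrm1 (h i).
Proof.
move=> hi; elim: s => [|i s IHs].
  rewrite big_nil; under eq_Rintegral do rewrite big_nil.
  by rewrite /Rintegral integral0.
rewrite big_cons -IHs; under eq_Rintegral do rewrite big_cons.
rewrite RintegralD//.
- by rewrite RintegralZl//; exact: integ_norm.
- by apply: integZ; exact: integ_norm.
- by apply: integ_sum => j; apply: integZ; exact: integ_norm.
Qed.

(** Integrates a pointwise inequality in [t]. This turns an inequality for real functions on the
    grid into one for $L_1$-valued functions. *)
Lemma le_sum_nrm1 (I J : Type) (s : seq I) (r : seq J) (c : I -> R) (d : J -> R)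
    (h : I -> T -> R) (k : J -> T -> R) :
  (forall i, integ (h i)) -> (forall j, integ (k j)) ->
  (forall t, \sum_(i <- s) c i * `|h i t| <= \sum_(j <- r) d j * `|k j t|) ->
  \sum_(i <- s) c i * nrm1 (h i) <= \sum_(j <- r) d j * nrm1 (k j).
Proof.
move=> hi ki hk; rewrite -!sum_nrm1//; apply: le_Rintegral => //.
- by apply: integ_sum => i; apply: integZ; exact: integ_norm.
- by apply: integ_sum => i; apply: integZ; exact: integ_norm.
Qed.

Lemma nrm1D g h : integ g -> integ h ->
  nrm1 (fun t => g t + h t) <= nrm1 g + nrm1 h.
Proof.
move=> gi hi; rewrite /nrm1 -RintegralD//; [|exact: integ_norm..].
apply: le_Rintegral => //.
- by apply: integ_norm; exact: integD.
- by apply: integD; exact: integ_norm.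
- by move=> t _; exact: ler_normD.
Qed.

Lemma nrm1Z c h : integ h -> nrm1 (fun t => c * h t) = `|c| * nrm1 h.
Proof.
move=> hi; rewrite /nrm1 -RintegralZl//; last exact: integ_norm.
by apply: eq_Rintegral => t _; rewrite normrM.
Qed.

Lemma nrm1N h : nrm1 (fun t => - h t) = nrm1 h.
Proof. by apply: eq_Rintegral => t _; rewrite normrN. Qed.

Lemma nrm1B g h : integ g -> integ h ->
  nrm1 (fun t => g t - h t) <= nrm1 g + nrm1 h.
Proof.
move=> gi hi; rewrite -[nrm1 h]nrm1N; apply: nrm1D => //.
have := integZ (-1) h hi; by under eq_fun do rewrite mulN1r.
Qed.

Lemma nrm1_sum (I : Type) (s : seq I) (h : I -> T -> R) :
  (forall i, integ (h i)) ->
  nrm1 (fun t => \sum_(i <- s) h i t) <= \sum_(i <- s) nrm1 (h i).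
Proof.
move=> hi; elim: s => [|i s IHs].
  rewrite big_nil; under eq_fun do rewrite big_nil.
  by rewrite nrm1_0.
rewrite big_cons; under eq_fun do rewrite big_cons.
apply: le_trans (nrm1D _ _ (hi i) (integ_sum _ _ _ hi)) _.
by rewrite lerD2l.
Qed.

End L1Seminorm.

(** * Averages along arithmetic progressions in an abelian group *)

Section Averages.
Context {R : realType} {V : zmodType}.
Variable M : nat.
Implicit Types (g h : V -> R) (u v w : V) (s : seq V).

Definition avg v g u : R := M%:R^-1 * \sum_(i < M) g (u + v *+ i).

(** Average over the box of all $u+\sum_{v\in s} i_v v$ with $0\le i_v<M$. *)
Definition avgs s g : V -> R := foldr avg g s.

Lemma avgs_cons v s g : avgs (v :: s) g = avg v (avgs s g).
Proof. by []. Qed.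

Lemma avg_comm v w g : avg v (avg w g) = avg w (avg v g).
Proof.
apply/funext => u; rewrite /avg; congr (_ * _).
rewrite -!mulr_sumr; congr (_ * _); rewrite exchange_big/=.
by apply: eq_bigr => j _; apply: eq_bigr => i _; rewrite addrAC.
Qed.

(** Averages in different directions commute, so the one along [v] can be performed first. *)
Lemma avgs_rem v s g : v \in s -> avgs s g = avgs (rem v s) (avg v g).
Proof.
have avgA r : avg v (avgs r g) = avgs r (avg v g).
  by elim: r => [//|w r IHr]; rewrite !avgs_cons avg_comm IHr.
elim: s => [//|w s IHs]; rewrite in_cons avgs_cons [rem _ _]/= eq_sym.
by have [->|_] := eqVneq w v => [_|/IHs ->]; [exact: avgA|].
Qed.

Lemma avgs_shift s w g u : avgs s (fun u' => g (u' + w)) u = avgs s g (u + w).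
Proof.
elim: s u => [//|v s IHs] u; rewrite !avgs_cons /avg; congr (_ * _).
by apply: eq_bigr => i _; rewrite IHs addrAC.
Qed.

Lemma avgsD s g h u : avgs s (fun u' => g u' + h u') u = avgs s g u + avgs s h u.
Proof.
elim: s u => [//|v s IHs] u; rewrite !avgs_cons /avg -mulrDr -big_split/=; congr (_ * _).
by apply: eq_bigr => i _; rewrite IHs.
Qed.

Lemma avgsZ s (c : R) g u : avgs s (fun u' => c * g u') u = c * avgs s g u.
Proof.
elim: s u => [//|v s IHs] u; rewrite !avgs_cons /avg [RHS]mulrCA; congr (_ * _); rewrite mulr_sumr.
by apply: eq_bigr => i _; rewrite IHs.
Qed.

Lemma avgsB s g h u : avgs s (fun u' => g u' - h u') u = avgs s g u - avgs s h u.
Proof.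
rewrite -[- avgs s h u]mulN1r -avgsZ -avgsD.
by congr (avgs _ _ _); apply/funext => u'; rewrite mulN1r.
Qed.

Hypothesis M_gt0 : (0 < M)%N.

Lemma avg_cst (c : R) v u : avg v (fun=> c) u = c.
Proof.
rewrite /avg sumr_const card_ord -[c *+ M]mulr_natl mulrA mulVf ?mul1r//.
by rewrite pnatr_eq0 -lt0n.
Qed.

Lemma avgs_cst (c : R) s u : avgs s (fun=> c) u = c.
Proof.
elim: s u => [//|v s IHs] u; rewrite avgs_cons.
by rewrite (_ : avgs s _ = fun=> c) ?avg_cst//; exact/funext.
Qed.

Lemma avgs_sum (I : Type) (r : seq I) (g : I -> V -> R) s u :
  avgs s (fun u' => \sum_(i <- r) g i u') u = \sum_(i <- r) avgs s (g i) u.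
Proof.
elim: r => [|i r IHr].
  by under eq_fun do rewrite big_nil; rewrite big_nil avgs_cst.
by under eq_fun do rewrite big_cons; rewrite big_cons avgsD IHr.
Qed.

Lemma le_avg v g h u : (forall u', g u' <= h u') -> avg v g u <= avg v h u.
Proof.
by move=> gh; rewrite ler_wpM2l ?invr_ge0//; apply: ler_sum.
Qed.

Lemma le_avgs s g h u : (forall u', g u' <= h u') -> avgs s g u <= avgs s h u.
Proof. by move=> gh; elim: s u => [//|v s IHs] u; exact: le_avg. Qed.

(** Once the average along [v] is innermost, the others are monotone and fix constants, so a uniform
    lower bound survives them. *)
Lemma avgs_ge v s (c : R) g u :
  v \in s -> (forall u', c <= avg v g u') -> c <= avgs s g u.
Proof.
by move=> /avgs_rem -> cg; rewrite -(avgs_cst c (rem v s) u); exact: le_avgs.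
Qed.

(** A unit step of the average is $1/M$ times one long increment of [g]; this is the gain from
    averaging. *)
Lemma avg_telescope v g u : avg v g (u + v) - avg v g u = M%:R^-1 * (g (u + v *+ M) - g u).
Proof.
rewrite /avg -mulrBr -sumrB; congr (_ * _).
have := telescope_sumr (fun i => g (u + v *+ i)) (leq0n M).
rewrite mulr0n addr0 => <-; rewrite big_mkord.
by apply: eq_bigr => i _; rewrite mulrS addrA.
Qed.

End Averages.

(** * Mollification of $L_1$-valued maps *)

Section Mollification.
Context {R : realType} {disp : measure_display} {T : measurableType disp}.
Variable m : {measure set T -> \bar R}.
Context {V : zmodType}.
Variables (M : nat) (M_gt0 : (0 < M)%N).
Implicit Types (H : V -> T -> R) (s : seq V).

Definition mollify s H (u : V) (t : T) : R := avgs M s (H^~ t) u.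

Lemma mollify_cons v s H u :
  mollify (v :: s) H u = fun t => M%:R^-1 * \sum_(i < M) mollify s H (u + v *+ i) t.
Proof. by []. Qed.

Lemma integ_mollify s H u : (forall u', integ m (H u')) -> integ m (mollify s H u).
Proof.
move=> Hi; elim: s u => [//|v s IHs] u; rewrite mollify_cons.
by apply: integZ; apply: integ_sum => i; exact: IHs.
Qed.

Lemma nrm1_mollify_le s H u (c : R) : (forall u', integ m (H u')) ->
  (forall u', nrm1 m (H u') <= c) -> nrm1 m (mollify s H u) <= c.
Proof.
move=> Hi Hc; elim: s u => [//|v s IHs] u.
have si i : integ m (mollify s H (u + v *+ i)) by exact: integ_mollify.
rewrite mollify_cons nrm1Z; last by apply: integ_sum.
rewrite ger0_norm ?invr_ge0// -[leRHS](avg_cst M M_gt0 _ v u).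
rewrite ler_wpM2l ?invr_ge0//.
apply: le_trans (nrm1_sum _ _ _ _ _) _; first by move=> i; exact: si.
by apply: ler_sum => i _.
Qed.

Lemma nrm1_mollifyB_le s H (v w : V) u (c : R) : (forall u', integ m (H u')) ->
  (forall u', nrm1 m (fun t => H (u' + v) t - H (u' + w) t) <= c) ->
  nrm1 m (fun t => mollify s H (u + v) t - mollify s H (u + w) t) <= c.
Proof.
move=> Hi Hc.
pose H' u' t := H (u' + v) t - H (u' + w) t.
have -> : (fun t => mollify s H (u + v) t - mollify s H (u + w) t) = mollify s H' u.
  by apply/funext => t; rewrite /mollify -!avgs_shift -avgsB.
by apply: nrm1_mollify_le => // u'; exact: integB.
Qed.

(** Telescoping along [v] leaves $1/M$ times the difference of two increments by [w], each of norm
    at most [c]. *)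
Lemma nrm1_mollify_second_diff s H (v w : V) u (c : R) : (forall u', integ m (H u')) ->
  (forall u', nrm1 m (fun t => H (u' + w) t - H u' t) <= c) -> v \in s ->
  nrm1 m (fun t => mollify s H (u + w + v) t - mollify s H (u + w) t
                   - (mollify s H (u + v) t - mollify s H u t)) <= 2 * c / M%:R.
Proof.
move=> Hi Hc vs.
pose H' u' t := M%:R^-1 * ((H (u' + v *+ M + w) t - H (u' + v *+ M) t)
                           - (H (u' + w) t - H u' t)).
rewrite (_ : (fun t => _) = mollify (rem v s) H' u); last first.
  apply/funext => t; rewrite /mollify !(avgs_rem _ _ _ _ vs).
  rewrite -!avgs_shift -!avgsB; congr (avgs _ _ _ _); apply/funext => u' /=.
  rewrite !avg_telescope /H' -mulrBr; congr (_ * _).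
  by rewrite (addrAC u' w); ring.
have di a : integ m (fun t => H (a + w) t - H a t) by exact: integB.
apply: nrm1_mollify_le => u'.
  by apply: integZ; apply: integB.
rewrite nrm1Z; last exact: integB.
rewrite ger0_norm ?invr_ge0// [leRHS]mulrC ler_wpM2l ?invr_ge0//.
apply: le_trans (nrm1B _ _ _ (di _) (di _)) _.
by rewrite mulr_natl mulr2n lerD.
Qed.

(** Induction on the directions: each one displaces the argument by [v *+ i] with $i<M$, at a cost
    of at most [kappa * M%:R]. *)
Lemma nrm1_mollify_dist s H (kappa : R) u : 0 <= kappa -> (forall u', integ m (H u')) ->
  (forall v u' i, v \in s -> nrm1 m (fun t => H (u' + v *+ i) t - H u' t) <= kappa * i%:R) ->
  nrm1 m (fun t => mollify s H u t - H u t) <= (size s)%:R * (kappa * M%:R).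
Proof.
move=> k0 Hi; elim: s u => [|v s IHs] u Hk.
  by rewrite mul0r; under eq_fun do rewrite subrr; rewrite nrm1_0.
have mi u' : integ m (mollify s H u') by exact: integ_mollify.
pose d i t := mollify s H (u + v *+ i) t - H u t.
have di i : integ m (d i) by exact: integB.
rewrite (_ : (fun t => _) = fun t => M%:R^-1 * \sum_(i < M) d i t); last first.
  apply/funext => t; rewrite /d sumrB mulrBr; congr (_ - _).
  exact/esym/(avg_cst M M_gt0 (H u t) v u).
rewrite nrm1Z; last by apply: integ_sum.
rewrite ger0_norm ?invr_ge0//.
rewrite ler_pdivrMl ?ltr0n//.
apply: le_trans (nrm1_sum _ _ _ _ _) _; first by move=> i; exact: di.
set C := _%:R * (_ * _).
rewrite (_ : _ * C = \sum_(i < M) C); last by rewrite sumr_const card_ord mulr_natl.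
apply: ler_sum => i _; rewrite {}/C.
pose d1 t := mollify s H (u + v *+ i) t - H (u + v *+ i) t.
pose d2 t := H (u + v *+ i) t - H u t.
rewrite (_ : d i = fun t => d1 t + d2 t); last first.
  by apply/funext => t; rewrite /d /d1 /d2 addrA subrK.
apply: le_trans (nrm1D _ _ _ _ _) _; [exact: integB..|].
rewrite /= -natr1 mulrDl mul1r; apply: lerD.
  by apply: IHs => v' u' j v's; apply: Hk; rewrite in_cons v's orbT.
apply: le_trans (Hk _ _ _ _) _; first by rewrite mem_head.
by rewrite ler_wpM2l// ler_nat ltnW.
Qed.

End Mollification.

(** * Transfer of a functional inequality to non-linear maps into $L_1$ *)

Section Linearization.
Context {R : realType} {disp : measure_display} {T : measurableType disp}.
Variable m : {measure set T -> \bar R}.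
Context {V : zmodType} {X I : finType}.
Variables (e : X -> V) (H : V -> T -> R) (omega : V -> R) (kappa W D C : R).
Variables (c L : I -> R) (sg : I -> X -> int) (E : seq (X * X)).

(** Integer signs keep these sums inside the abelian group [V]. Partial lists [s] occur because the
    linearization adds one point at a time. *)
Let mu i (s : seq X) : V := \sum_(x <- s) e x *~ sg i x.

Hypothesis Hi : forall u, integ m (H u).
Hypothesis H_omega : forall u v, nrm1 m (fun t => H (u + v) t - H u t) <= omega v.
Hypothesis kappa_ge0 : 0 <= kappa.
Hypothesis omega_e : forall x i, omega (e x *+ i) <= kappa * i%:R.
Hypothesis sg_le1 : forall i x, `|sg i x| <= 1.
Hypothesis omega_mu : forall i s, uniq s -> omega (mu i s) <= W.
Hypothesis c_ge0 : forall i, 0 <= c i.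
Hypothesis H_lower : forall i u j,
  j%:R * L i <= nrm1 m (fun t => H (u + mu i (enum X) *+ j) t - H u t).
Hypothesis H_edge : forall u p, p \in E ->
  nrm1 m (fun t => H (u + e p.1) t - H (u + e p.2) t) <= D.
Hypothesis C_ge0 : 0 <= C.
Hypothesis functional_ineq : forall f : X -> R,
  \sum_i c i * `|\sum_x (sg i x)%:~R * f x| <= C * \sum_(p <- E) `|f p.1 - f p.2|.

Section FixedScale.
Variables (M : nat) (M_gt0 : (0 < M)%N).

Let Hm := mollify M [seq e x | x <- enum X] H.

Let Hmi u : integ m (Hm u).
Proof. exact: integ_mollify. Qed.

(** The value on [mu i s] of the linear map whose value on [e x] is the discrete derivative of [Hm]
    at [u] in that direction. *)
Let lin i (s : seq X) u t : R := \sum_(x <- s) (sg i x)%:~R * (Hm (u + e x) t - Hm u t).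

Let lini i s u : integ m (lin i s u).
Proof. by apply: integ_sum => x; apply: integZ; exact: integB. Qed.

(** Points are added one at a time. Each adds to the error at most one second difference, of norm at
    most $2W/M$ because [e x] is a mollifying direction. *)
Lemma mollify_almost_linear i s u : uniq s ->
  nrm1 m (fun t => Hm (u + mu i s) t - Hm u t - lin i s u t) <= (size s)%:R * (2 * W / M%:R).
Proof.
elim: s => [_|x s IHs xs].
  by rewrite mul0r /mu /lin; under eq_fun do rewrite !big_nil addr0 !subrr; rewrite nrm1_0.
have us : uniq s by case/andP: xs.
have ex_in : e x \in [seq e x | x <- enum X] by rewrite map_f// mem_enum.
have second_diff r : uniq r -> nrm1 m (fun t => Hm (u + mu i r + e x) t - Hm (u + mu i r) t
    - (Hm (u + e x) t - Hm u t)) <= 2 * W / M%:R.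
  move=> ur; apply: nrm1_mollify_second_diff => // u'.
  exact: le_trans (H_omega _ _) (omega_mu i r ur).
pose d t := Hm (u + mu i (x :: s)) t - Hm (u + mu i s) t - (sg i x)%:~R * (Hm (u + e x) t - Hm u t).
have di : integ m d by apply: integB; [exact: integB|apply: integZ; exact: integB].
rewrite (_ : (fun t => _) = fun t => d t + (Hm (u + mu i s) t - Hm u t - lin i s u t)); last first.
  by apply/funext => t; rewrite /d /lin big_cons; ring.
apply: le_trans (nrm1D _ _ _ _ _) _ => //; first by apply: integB => //; exact: integB.
rewrite /= -natr1 mulrDl mul1r addrC lerD//; first exact: IHs.
have muE : mu i (x :: s) = mu i s + e x *~ sg i x by rewrite /mu big_cons addrC.
have [sg0|[sg1|sgN]] : sg i x = 0 \/ sg i x = 1 \/ sg i x = -1.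
  by have := sg_le1 i x; lia.
- rewrite (_ : d = fun=> 0) ?nrm1_0; first exact: le_trans (nrm1_ge0 _ _) (second_diff _ us).
  by apply/funext => t; rewrite /d muE sg0 mulr0z addr0 mul0r !subrr.
- have := second_diff _ us; rewrite (_ : (fun t => _) = d)//; apply/funext => t.
  by rewrite /d muE sg1 mulr1z addrA mul1r.
(* For sign $-1$, adding [e x] leads from [mu i (x :: s)] back to [mu i s], so the second difference
   is based at the former and read backwards. *)
- rewrite -nrm1N; have := second_diff _ xs.
  rewrite muE sgN mulrN1z addrA subrK (_ : (fun t => _) = fun t => - d t)//.
  by apply/funext => t; rewrite /d muE sgN mulrN1z addrA; ring.
Qed.

(** The increments of [Hm] over [J] steps along [mu i (enum X)] telescope to one long increment,
    where [H_lower] applies. Replacing [H] by [Hm] at the two ends costs the first error, divided by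
    [J]; linearizing every step costs the second. *)
Lemma linear_part_lower i (J : nat) u : (0 < J)%N ->
  L i - (2 * #|X|%:R * (kappa * M%:R) / J%:R + #|X|%:R * (2 * W / M%:R))
  <= avg J (mu i (enum X)) (fun u' => nrm1 m (lin i (enum X) u')) u.
Proof.
move=> J_gt0; set v := mu i _; set p : R := #|X|%:R; set q := p * (2 * W / _).
have sizeX (A : finType) : size (enum A) = #|A| by rewrite cardE.
have J0 : (0 : R) < J%:R by rewrite ltr0n.
rewrite /avg ler_pdivlMl//.
have step a : nrm1 m (fun t => Hm (a + v) t - Hm a t) <= nrm1 m (lin i (enum X) a) + q.
  rewrite (_ : (fun t => _) = fun t => lin i (enum X) a t +
      (Hm (a + v) t - Hm a t - lin i (enum X) a t)); last first.
    by apply/funext => t; ring.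
  apply: le_trans (nrm1D _ _ _ _ _) _ => //; first by apply: integB => //; exact: integB.
  rewrite lerD2l /q /p -sizeX; apply: mollify_almost_linear; exact: enum_uniq.
have dist a : nrm1 m (fun t => Hm a t - H a t) <= p * (kappa * M%:R).
  rewrite /p -sizeX -(size_map e); apply: nrm1_mollify_dist => // w u' j /mapP[x _ ->].
  exact: le_trans (H_omega _ _) (omega_e _ _).
have tele : nrm1 m (fun t => Hm (u + v *+ J) t - Hm u t)
    <= \sum_(j < J) (nrm1 m (lin i (enum X) (u + v *+ j)) + q).
  rewrite (_ : (fun t => _) = fun t => \sum_(j < J) (Hm (u + v *+ j + v) t - Hm (u + v *+ j) t)).
    apply: le_trans (nrm1_sum _ _ _ _ _) _; first by move=> j; exact: integB.
    by apply: ler_sum => j _; exact: step.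
  apply/funext => t; have := telescope_sumr (fun j => Hm (u + v *+ j) t) (leq0n J).
  rewrite mulr0n addr0 => <-; rewrite big_mkord; apply: eq_bigr => j _.
  by rewrite mulrSr addrA.
have low : J%:R * L i <= nrm1 m (fun t => Hm (u + v *+ J) t - Hm u t) + 2 * (p * (kappa * M%:R)).
  apply: le_trans (H_lower i u J) _.
  rewrite (_ : (fun t => _) = fun t => (Hm (u + v *+ J) t - Hm u t) +
     ((Hm u t - H u t) - (Hm (u + v *+ J) t - H (u + v *+ J) t))); last first.
    by apply/funext => t; rewrite -/v; ring.
  apply: le_trans (nrm1D _ _ _ _ _) _; [exact: integB|by apply: integB; exact: integB|].
  rewrite lerD2l; apply: le_trans (nrm1B _ _ _ _ _) _; [exact: integB|exact: integB|].
  by rewrite mulr_natl mulr2n lerD.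
move: (le_trans low (lerD tele (lexx _))).
rewrite big_split/= sumr_const card_ord -[q *+ J]mulr_natl.
rewrite mulrBr mulrDr => h.
rewrite [X in _ - (X + _)](_ : _ = 2 * (p * (kappa * M%:R))); last by field; rewrite gt_eqF.
lra.
Qed.

(** For fixed [t] the scalar inequality is applied to the derivatives [Hm (u + e x) t - Hm u t]. On
    an edge the base value cancels, and integration in [t] makes [H_edge] available. *)
Lemma linear_part_upper u :
  \sum_i c i * nrm1 m (lin i (enum X) u) <= C * (D * (size E)%:R).
Proof.
have h : \sum_i c i * nrm1 m (lin i (enum X) u)
    <= \sum_(p <- E) C * nrm1 m (fun t => Hm (u + e p.1) t - Hm (u + e p.2) t).
  apply: (le_sum_nrm1 m _ _ _ _ c (fun=> C) (fun i => lin i (enum X) u)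
    (fun p t => Hm (u + e p.1) t - Hm (u + e p.2) t)) => [i|p|t]; [exact: lini|exact: integB|].
  have := functional_ineq (fun x => Hm (u + e x) t - Hm u t).
  rewrite mulr_sumr.
  under eq_bigr do rewrite -big_enum.
  by under [X in _ <= X -> _]eq_bigr do rewrite opprB addrA subrK.
apply: le_trans h _; rewrite -mulr_sumr ler_wpM2l//.
apply: (@le_trans _ _ (\sum_(p <- E) D)); last first.
  by rewrite mulr_natr big_const_seq count_predT iter_addr_0 lexx.
rewrite big_seq [leRHS]big_seq; apply: ler_sum => p pE.
by apply: nrm1_mollifyB_le => // u'; exact: H_edge.
Qed.

(** The upper estimate holds at every base point, hence also after averaging the base point along
    all directions [mu i (enum X)]; this single average satisfies the lower estimate for every [i]
    at once. *)
Lemma functional_ineq_approx :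
  \sum_i c i * L i <= C * (D * (size E)%:R)
    + (\sum_i c i) * (2 * #|X|%:R * (kappa + W)) / M%:R.
Proof.
have M0 : (0 : R) < M%:R by rewrite ltr0n.
(* Segments of length $M^2$ against boxes of side $M$ make both errors of order $1/M$. *)
pose J := (M * M)%N; pose err := 2 * #|X|%:R * (kappa + W) / M%:R.
have J0 : (0 < J)%N by rewrite muln_gt0 M_gt0.
have low i : L i - err <= avgs J [seq mu i (enum X) | i <- enum I]
    (fun u => nrm1 m (lin i (enum X) u)) 0.
  apply: (avgs_ge _ J0 (mu i (enum X))) => [|u].
    by apply/mapP; exists i; rewrite ?mem_enum.
  apply: le_trans (linear_part_lower i J u J0).
  rewrite /err /J natrM le_eqVlt; apply/orP; left; apply/eqP; congr (_ - _); field.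
  by rewrite gt_eqF.
have up : \sum_i c i * (L i - err) <= C * (D * (size E)%:R).
  rewrite -[leRHS](avgs_cst _ J0 _ [seq mu i (enum X) | i <- enum I] 0).
  apply: (@le_trans _ _ (avgs J [seq mu i (enum X) | i <- enum I]
    (fun u => \sum_i c i * nrm1 m (lin i (enum X) u)) 0)); last first.
    by apply: le_avgs => u; exact: linear_part_upper.
  rewrite avgs_sum//.
  by apply: ler_sum => i _; rewrite avgsZ ler_wpM2l.
move: up; under eq_bigr do rewrite mulrBr.
by rewrite sumrB -mulr_suml -mulrA -/err; lra.
Qed.

End FixedScale.

Theorem functional_ineq_transfer : \sum_i c i * L i <= C * (D * (size E)%:R).
Proof.
rewrite leNgt; apply/negP => lt.
set A := \sum_i _ in lt; set B := C * _ in lt.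
pose K := (\sum_i c i) * (2 * #|X|%:R * (kappa + W)).
(* Large enough for the error $K/M$ to be smaller than the supposed gap $A-B$. *)
pose M := (Num.truncn (`|K| / (A - B))).+1.
have := @functional_ineq_approx M isT; rewrite -/A -/B -/K.
have AB : 0 < A - B by rewrite subr_gt0.
have : `|K| / (A - B) < M%:R by exact: truncnS_gt.
rewrite ltr_pdivrMr// => hK h.
have : A - B <= `|K| / M%:R.
  rewrite lerBlDl; apply: le_trans h _; rewrite lerD2l ler_wpM2r ?invr_ge0//; exact: ler_norm.
by rewrite ler_pdivlMr ?ltr0n// mulrC leNgt hK.
Qed.

End Linearization.

(** * Coarea formula: from indicators to arbitrary functions *)

Section Coarea.
Context {R : realType} {X : finType}.
Variables (E : seq (X * X)) (Psi : (X -> R) -> R) (C : R).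
Hypothesis PsiD : forall f g, Psi (fun x => f x + g x) <= Psi f + Psi g.
Hypothesis PsiZ : forall c f, 0 <= c -> Psi (fun x => c * f x) <= c * Psi f.
Hypothesis Psi_cst : forall c, Psi (fun=> c) <= 0.
Hypothesis C_ge0 : 0 <= C.
Hypothesis Psi_indic : forall S : pred X,
  Psi (fun x => (S x)%:R) <= C * \sum_(p <- E) `|(S p.1)%:R - (S p.2)%:R|.

(** The top level set is peeled off repeatedly, by induction on the number of points where [f] lies
    below an upper bound [M]. *)
Lemma coarea_le f : Psi f <= C * \sum_(p <- E) `|f p.1 - f p.2|.
Proof.
have [M fM] : exists M, forall x, f x <= M.
  exists (\sum_x `|f x|) => x; rewrite (bigD1 x)//=.
  by rewrite (le_trans (ler_norm _))// lerDl sumr_ge0.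
have [k] := ubnP #|[pred x | f x < M]|.
elim: k => // k IHk in f M fM *; rewrite ltnS => cardk.
have [x1 x1M|noM] := pickP [pred x | f x < M]; last first.
  rewrite (_ : f = fun=> M); last first.
    by apply/funext => x; apply/eqP; rewrite eq_le fM/= leNgt; have := noM x => /= ->.
  by apply: le_trans (Psi_cst M) _; rewrite mulr_ge0// sumr_ge0.
case: (@arg_maxP _ _ _ x1 [pred x | f x < M] f x1M) => /= x2 x2M x2max.
set v := f x2 in x2max x2M.
(* As [v] is the largest value below [M], [f] equals [g] plus $M-v$ times the indicator of [S]. *)
pose g x := Num.min (f x) v; pose S := [pred x | f x == M].
have gS x : (f x <= v /\ S x = false) \/ (f x = M /\ S x = true).
  have := fM x; rewrite le_eqVlt => /orP[/eqP fxM|fxM].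
    by right; rewrite /S /= fxM eqxx.
  by left; split; [exact: x2max|rewrite /S /= lt_eqF].
have fE x : f x = g x + (M - v) * (S x)%:R.
  rewrite /g; case: (gS x) => -[fx ->].
    by rewrite min_l// mulr0 addr0.
  by rewrite fx min_r ?(ltW x2M)// mulr1; ring.
have gv x : g x <= v by rewrite /g ge_min lexx orbT.
have IHg : Psi g <= C * \sum_(p <- E) `|g p.1 - g p.2|.
  apply: (IHk _ v gv); apply: leq_trans cardk; apply: proper_card.
  apply/properP; split; last by exists x2; rewrite !inE ?x2M// /g minxx ltxx.
  apply/fintype.subsetP => x; rewrite !inE /g gt_min ltxx orbF => fx.
  by rewrite (lt_trans fx).
have Mv : 0 <= M - v by rewrite subr_ge0 ltW.
(* Both pieces are nondecreasing functions of [f], so their variations add without cancellation. *)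
have TVE (p : X * X) : `|f p.1 - f p.2| =
    `|g p.1 - g p.2| + (M - v) * `|(S p.1)%:R - (S p.2)%:R|.
  rewrite /g; case: (gS p.1) => -[f1 S1]; case: (gS p.2) => -[f2 S2]; rewrite S1 S2.
  - by rewrite !min_l// subrr normr0 mulr0 addr0.
  - rewrite (min_l f1) f2 (min_r (ltW x2M)) sub0r normrN1 mulr1.
    rewrite ler0_norm ?subr_le0; last by rewrite (le_trans f1)// ltW.
    by rewrite ler0_norm ?subr_le0//; ring.
  - rewrite (min_l f2) f1 (min_r (ltW x2M)) subr0 normr1 mulr1.
    rewrite ger0_norm ?subr_ge0; last by rewrite (le_trans f2)// ltW.
    by rewrite ger0_norm ?subr_ge0//; ring.
  - by rewrite f1 f2 !subrr !normr0 mulr0 addr0.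
under eq_bigr do rewrite TVE.
rewrite big_split/= mulrDr -mulr_sumr.
rewrite [in leLHS](_ : f = fun x => g x + (M - v) * (S x)%:R); last exact/funext.
apply: le_trans (PsiD _ _) _; apply: lerD => //.
apply: le_trans (PsiZ _ _ Mv) _.
by rewrite mulrCA ler_wpM2l.
Qed.

End Coarea.

(** * Orthogonality of random signs *)

(** Flipping the sign at [phi q] is an involution of the sign patterns that negates every mixed
    term, so only the squares remain. *)
Lemma rademacher_second_moment {R : realType} {Q I : finType} (phi : Q -> I) (z : Q -> R) :
  injective phi ->
  \sum_(eps : {ffun I -> bool}) (\sum_q (-1) ^+ eps (phi q) * z q) ^+ 2
  = #|{ffun I -> bool}|%:R * \sum_q z q ^+ 2.
Proof.
move=> phi_inj; pose A := {ffun I -> bool}.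
have orth q r : \sum_(eps : A) ((-1) ^+ eps (phi q) * (-1) ^+ eps (phi r) : R)
    = if q == r then #|A|%:R else 0.
  have [->|qr] := eqVneq q r.
    under eq_bigr do rewrite -expr2 sqrr_sign.
    by rewrite sumr_const.
  pose flip (eps : A) : A := [ffun i => if i == phi q then ~~ eps i else eps i].
  have flipK : involutive flip.
    by move=> eps; apply/ffunP => i; rewrite !ffunE; case: eqP => //; rewrite negbK.
  set s := LHS; suff: s = - s by move=> h; lra.
  rewrite {1}/s (reindex_inj (inv_inj flipK)) -sumrN; apply: eq_bigr => eps _ /=.
  rewrite !ffunE eqxx (inj_eq phi_inj) (negPf (_ : r != q)) 1?eq_sym//.
  by rewrite signrN mulNr.
under eq_bigr => eps _.
  rewrite expr2 big_distrlr/=.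
  under eq_bigr => q _ do under eq_bigr => r _ do rewrite mulrACA.
  over.
rewrite exchange_big/= mulr_sumr; apply: eq_bigr => q _.
rewrite exchange_big/= (bigD1 q)//= [X in _ + X]big1 => [|r rq].
  by rewrite -mulr_suml orth eqxx addr0 expr2.
by rewrite -mulr_suml orth eq_sym (negPf rq) mul0r.
Qed.

(** * Discrete area, perimeter and the isoperimetric inequality *)

Definition area (l : nat) (S : nat -> nat -> bool) : nat :=
  \sum_(i < l) \sum_(j < l) S i j.

(** Edges leaving the square on the right and at the top are counted, so that in a subdivision every
    edge belongs to exactly one block. *)
Definition perim (l : nat) (S : nat -> nat -> bool) : nat :=
  \sum_(i < l) \sum_(j < l) ((S i.+1 j != S i j) + (S i j.+1 != S i j)).

Lemma area_le (n : nat) (U : nat -> nat -> bool) : (area n U <= n ^ 2)%N.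
Proof.
rewrite /area; apply: leq_trans (_ : \sum_(i < n) \sum_(j < n) 1 <= _)%N.
  by apply: leq_sum => i _; apply: leq_sum => j _; case: (U _ _).
by rewrite sum_nat_const sum1_card !card_ord mulnn.
Qed.

(* A pure row and a pure column share a colour; every point of the other colour lies in
   a mixed row and in a mixed column. *)
Lemma isoperimetric (l : nat) (S : nat -> nat -> bool) :
  (minn (area l S) (area l (fun i j => ~~ S i j)) <= perim l S ^ 2)%N.
Proof.
have const (g : nat -> bool) : (\sum_(i < l) (g i.+1 != g i) = 0)%N ->
    forall i j, (i < l)%N -> (j < l)%N -> g i = g j.
  move/eqP; rewrite sum_nat_eq0 => /forallP g0.
  suff g00 i : (i < l)%N -> g i = g 0%N by move=> i j il jl; rewrite !g00.
  elim: i => // i IHi il; rewrite -IHi; last exact: ltnW.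
  by have := g0 (Ordinal (ltnW il)); rewrite /= eqb0 negbK => /eqP.
pose row j := (\sum_(i < l) (S i.+1 j != S i j))%N.
pose col i := (\sum_(j < l) (S i j.+1 != S i j))%N.
have perimE : perim l S = (\sum_(j < l) row j + \sum_(i < l) col i)%N.
  rewrite /perim /row /col; under eq_bigr do rewrite big_split/=.
  by rewrite big_split/=; congr (_ + _)%N; rewrite exchange_big.
(* This settles the case without a pure row or without a pure column: the perimeter is then at least
   [l], and no area exceeds $l^2$. *)
have big_perim :
    (l <= perim l S -> minn (area l S) (area l (fun i j => ~~ S i j)) <= perim l S ^ 2)%N.
  by move=> lp; rewrite geq_min (leq_trans (area_le _ _))// leq_exp2r.
have all_pos (h : nat -> nat) : (forall j : 'I_l, h j != 0)%N -> (l <= \sum_(j < l) h j)%N.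
  move=> h0; rewrite -[X in (X <= _)%N]card_ord -sum1_card; apply: leq_sum => j _.
  by rewrite lt0n h0.
case: (pickP (fun j : 'I_l => row j == 0%N)) => [j0 /eqP rj0|rows]; last first.
  apply: big_perim; rewrite perimE; apply: leq_trans (leq_addr _ _).
  by apply: all_pos => j; rewrite rows.
case: (pickP (fun i : 'I_l => col i == 0%N)) => [i0 /eqP ci0|cols]; last first.
  apply: big_perim; rewrite perimE; apply: leq_trans (leq_addl _ _).
  by apply: all_pos => j; rewrite cols.
pose U i j := S i j != S i0 j0.
have UP : (area l U <= perim l S ^ 2)%N.
  (* The double sum factors into total column changes times total row changes, which is at most the
     squared perimeter. *)
  apply: (@leq_trans (\sum_(i < l) \sum_(j < l) col i * row j)).
    apply: leq_sum => i _; apply: leq_sum => j _; rewrite /U.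
    have [//|Sij] := eqVneq (S i j) (S i0 j0).
    rewrite muln_gt0 !lt0n; apply/andP; split; apply/negP => /eqP h0.
      have h1 := const (S i) h0 j j0 (ltn_ord j) (ltn_ord j0).
      have h2 := const (fun i => S i j0) rj0 i i0 (ltn_ord i) (ltn_ord i0).
      by move/eqP: Sij; rewrite h1 h2.
    have h1 := const (fun i => S i j) h0 i i0 (ltn_ord i) (ltn_ord i0).
    have h2 := const (S i0) ci0 j j0 (ltn_ord j) (ltn_ord j0).
    by move/eqP: Sij; rewrite h1 h2.
  rewrite -big_distrlr/= perimE -mulnn.
  by move: (\sum_(i < l) col i)%N (\sum_(j < l) row j)%N => a b; nia.
rewrite geq_min; case: (S i0 j0) @U UP => /= UP.
  apply/orP; right; apply: leq_trans UP; rewrite /area.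
  by apply: leq_sum => i _; apply: leq_sum => j _; case: (S i j).
apply/orP; left; apply: leq_trans UP; rewrite /area.
by apply: leq_sum => i _; apply: leq_sum => j _; case: (S i j).
Qed.

(** * Splitting sums over a square into blocks *)

Lemma big_ord_blocks (A : Type) (idx : A) (op : Monoid.law idx) (B l : nat) (G : nat -> A) :
  \big[op/idx]_(x < B * l) G x = \big[op/idx]_(q < B) \big[op/idx]_(i < l) G (q * l + i)%N.
Proof.
elim: B => [|B IHB]; first by rewrite mul0n !big_ord0.
by rewrite mulSn addnC big_split_ord/= IHB big_ord_recr.
Qed.

Lemma big_ord_blocks2 (A : Type) (idx : A) (op : Monoid.com_law idx) (B l : nat)
    (G : nat -> nat -> A) :
  \big[op/idx]_(x < B * l) \big[op/idx]_(y < B * l) G x y =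
  \big[op/idx]_(q < B) \big[op/idx]_(r < B) \big[op/idx]_(i < l) \big[op/idx]_(j < l)
     G (q * l + i)%N (r * l + j)%N.
Proof.
rewrite (big_ord_blocks _ _ _ _ _ (fun x => \big[op/idx]_(y < B * l) G x y)).
apply: eq_bigr => q _; rewrite [RHS]exchange_big/=; apply: eq_bigr => i _.
exact: (big_ord_blocks _ _ _ _ _ (G (q * l + i)%N)).
Qed.

(** * Block Haar functions with signs, tested on indicators *)

Section BlockSigns.
Context {R : realType}.
Variables (a B : nat).
Hypothesis a_gt0 : (0 < a)%N.
Let l := (2 * a)%N.
Let N := (B * l)%N.
Implicit Types S : nat -> nat -> bool.

(** The pairing of [f] with $\mu_\varepsilon$: the parity of [x %/ a] is the horizontal Haar sign,
    $+1$ on the left half of each block and $-1$ on the right half. *)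
Definition sign_pairing (eps : nat -> nat -> bool) (f : nat -> nat -> R) : R :=
  \sum_(x < N) \sum_(y < N) (-1) ^+ eps (x %/ l)%N (y %/ l)%N * (-1) ^+ (x %/ a) * f x y.

Definition haar (f : nat -> nat -> R) : R :=
  \sum_(i < l) \sum_(j < l) (-1) ^+ (i %/ a) * f i j.

Definition block (A : Type) (f : nat -> nat -> A) (q r i j : nat) : A :=
  f (q * l + i)%N (r * l + j)%N.

Let l_gt0 : (0 < l)%N. Proof. by rewrite muln_gt0. Qed.

Lemma sign_pairingE eps f :
  sign_pairing eps f = \sum_(q < B) \sum_(r < B) (-1) ^+ eps q r * haar (block _ f q r).
Proof.
rewrite /sign_pairing (big_ord_blocks2 _ _ _ _ _ (fun x y =>
  (-1) ^+ eps (x %/ l)%N (y %/ l)%N * (-1) ^+ (x %/ a) * f x y)).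
apply: eq_bigr => q _; apply: eq_bigr => r _; rewrite mulr_sumr; apply: eq_bigr => i _.
rewrite mulr_sumr; apply: eq_bigr => j _.
have blockE (p : nat) (h : 'I_l) : ((p * l + h) %/ l = p)%N.
  by rewrite divnMDl// divn_small// addn0.
rewrite !blockE mulrA; congr (_ * _ * _).
by rewrite (mulnA q 2 a : (q * l)%N = _) divnMDl// exprD -signr_odd oddM andbF mul1r.
Qed.

Lemma haar_cst c : haar (fun _ _ => c) = 0.
Proof.
rewrite /haar (big_ord_blocks _ _ _ _ _ (fun i => \sum_(j < l) (-1) ^+ (i %/ a) * c)).
rewrite big_ord_recl big_ord1/=.
under eq_bigr do rewrite mul0n add0n divn_small// expr0 mul1r.
under [X in _ + X]eq_bigr do rewrite mul1n divnDl// divnn a_gt0 divn_small// addn0 expr1 mulN1r.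
by under [X in _ + X]eq_bigr do rewrite sumrN; rewrite sumrN subrr.
Qed.

(** The Haar function annihilates constants, so a set may be replaced by its complement. *)
Lemma haar_indic_le (S : nat -> nat -> bool) :
  `|haar (fun i j => (S i j)%:R)| <= (minn (area l S) (area l (fun i j => ~~ S i j)))%:R.
Proof.
have le_area (U : nat -> nat -> bool) : `|haar (fun i j => (U i j)%:R)| <= (area l U)%:R.
  rewrite /haar /area natr_sum; apply: le_trans (ler_norm_sum _ _ _) _.
  apply: ler_sum => i _; rewrite natr_sum; apply: le_trans (ler_norm_sum _ _ _) _.
  by apply: ler_sum => j _; rewrite normrM normrX normrN1 expr1n mul1r normr_nat.
rewrite -minEnat natr_min le_min le_area/=.
suff -> : haar (fun i j => (S i j)%:R) = - haar (fun i j => (~~ S i j)%:R).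
  by rewrite normrN le_area.
apply/eqP; rewrite -addr_eq0 -(haar_cst 1) /haar -big_split/=; apply/eqP.
apply: eq_bigr => i _; rewrite -big_split/=; apply: eq_bigr => j _.
by rewrite -mulrDr; case: (S i j); rewrite ?addr0 ?add0r.
Qed.

Lemma perim_blocks S : perim N S = (\sum_(q < B) \sum_(r < B) perim l (block _ S q r))%N.
Proof.
rewrite /perim (big_ord_blocks2 _ _ _ _ _ (fun x y => (S x.+1 y != S x y) + (S x y.+1 != S x y))%N).
by under [RHS]eq_bigr => q _ do under eq_bigr => r _ do under eq_bigr => i _ do
  under eq_bigr => j _ do rewrite /block !addnS.
Qed.

Lemma haar_block_le S q r : `|haar (fun i j => (block _ S q r i j)%:R)|
  <= (perim l (block _ S q r))%:R ^+ 2.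
Proof. by rewrite (le_trans (haar_indic_le _))// -natrX ler_nat isoperimetric. Qed.

Lemma haar_block_sqr S q r : haar (fun i j => (block _ S q r i j)%:R) ^+ 2
  <= l%:R ^+ 3 * (perim l (block _ S q r))%:R.
Proof.
set P := perim _ _; have h1 := haar_block_le S q r.
have h2 : `|haar (fun i j => (block _ S q r i j)%:R)| <= l%:R ^+ 2.
  apply: le_trans (haar_indic_le _) _; rewrite -natrX ler_nat geq_min.
  by rewrite area_le.
rewrite -/P in h1; rewrite -real_normK ?num_real//.
move: (`|haar _|) (normr_ge0 (haar (fun i j => (block _ S q r i j)%:R))) h1 h2 => z z0 h1 h2.
(* The geometric mean of the two bounds $P^2$ and $l^2$. *)
have h3 : z <= l%:R * P%:R.
  rewrite -(@ler_pXn2r _ 2) ?nnegrE ?mulr_ge0// exprMn expr2.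
  by apply: ler_pM.
rewrite expr2 exprSr -mulrA; exact: ler_pM.
Qed.

(** Valid for every choice of signs: the squared block perimeters sum to at most the square of their
    sum. *)
Lemma sign_pairing_indic_le eps S :
  `|sign_pairing eps (fun i j => (S i j)%:R)| <= (perim N S)%:R ^+ 2.
Proof.
have sum_sqr n (g : 'I_n -> R) : (forall i, 0 <= g i) -> \sum_i g i ^+ 2 <= (\sum_i g i) ^+ 2.
  move=> g0; rewrite expr2 mulr_suml; apply: ler_sum => i _; rewrite expr2 ler_wpM2l//.
  by rewrite (bigD1 i)//= lerDl sumr_ge0.
rewrite sign_pairingE perim_blocks natr_sum.
apply: le_trans (sum_sqr _ _ _); last by move=> q.
apply: le_trans (ler_norm_sum _ _ _) _; apply: ler_sum => q _.
rewrite natr_sum; apply: le_trans (sum_sqr _ _ _); last by move=> r.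
apply: le_trans (ler_norm_sum _ _ _) _; apply: ler_sum => r _.
by rewrite normrM normr_sign mul1r haar_block_le.
Qed.

(** Orthogonality leaves the sum of squared block coefficients, each at most $l^3$ times the block
    perimeter. *)
Lemma sign_pairing_indic_sqr (I : finType) (idx : nat -> nat -> I) S :
  (forall q r q' r', (q < B)%N -> (r < B)%N -> (q' < B)%N -> (r' < B)%N ->
     idx q r = idx q' r' -> q = q' /\ r = r') ->
  \sum_(eps : {ffun I -> bool})
     sign_pairing (fun q r => eps (idx q r)) (fun i j => (S i j)%:R) ^+ 2
  <= #|{ffun I -> bool}|%:R * (l%:R ^+ 3 * (perim N S)%:R).
Proof.
move=> idx_inj; pose phi (q : 'I_B * 'I_B) := idx q.1 q.2.
have phi_inj : injective phi.
  move=> [q r] [q' r'] /(idx_inj _ _ _ _ (ltn_ord q) (ltn_ord r) (ltn_ord q') (ltn_ord r')).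
  by move=> [/val_inj -> /val_inj ->].
under eq_bigr do rewrite sign_pairingE pair_big/=.
rewrite (rademacher_second_moment phi
  (fun q => haar (block _ (fun i j => (S i j)%:R) q.1 q.2)) phi_inj).
rewrite ler_wpM2l// perim_blocks.
rewrite -(pair_bigA _ (fun q r : 'I_B => haar (block _ (fun i j => (S i j)%:R) q r) ^+ 2))/=.
rewrite natr_sum mulr_sumr; apply: ler_sum => q _.
rewrite natr_sum mulr_sumr; apply: ler_sum => r _.
exact: haar_block_sqr.
Qed.

End BlockSigns.

(** * Summation over the scales *)

Lemma sum_pow2_trunc (K m : nat) :
  (\sum_(k < K) (k.+2 <= m) * 2 ^ k.+2 <= 2 ^ m.+1)%N.
Proof.
apply: (@leq_trans (2 ^ (minn K.+1 m).+1)); last by rewrite leq_exp2l// ltnS geq_minr.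
elim: K => [|K IHK]; first by rewrite big_ord0.
rewrite big_ord_recr/=; apply: leq_trans (leq_add IHK (leqnn _)) _.
have [Km|Km] := leqP K.+2 m.
  by rewrite (minn_idPl (ltnW Km)) mul1n addnn -mul2n -expnS.
by rewrite mul0n addn0; apply: leq_pexp2l => //; lia.
Qed.

Lemma sum_inv_pow4_tail {R : realType} (K m : nat) :
  \sum_(k < K) (m < k.+2)%N%:R * (4 ^- k.+2 : R) <= 4 / 3 * 4 ^- m.+1.
Proof.
(* The subtracted tail of the geometric series is what makes the induction on [K] close. *)
apply: (@le_trans _ _ (4 / 3 * (4 ^- m.+1 - 4 ^- maxn K.+2 m.+1))); last first.
  by rewrite ler_wpM2l ?divr_ge0// gerBl invr_ge0 exprn_ge0.
elim: K => [|K IHK].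
  rewrite big_ord0 mulr_ge0 ?divr_ge0// subr_ge0 lef_pV2 ?posrE ?exprn_gt0//.
  by rewrite ler_eXn2l ?ltr1n// leq_maxr.
have step : (4 ^- K.+3 : R) = 4^-1 * 4 ^- K.+2 by rewrite (exprS _ K.+2) invfM.
rewrite big_ord_recr [nat_of_ord _]/=; apply: le_trans (lerD IHK (lexx _)) _.
have [Km|Km] := ltnP m K.+2.
  rewrite !(maxn_idPl _)//; last exact: ltnW.
  rewrite mul1r step.
  by set y := (4 ^- K.+2 : R); set z := (4 ^- m.+1 : R); lra.
by rewrite mul0r addr0 !(maxn_idPr _)// ltnW.
Qed.

(** With $l=4^{k+2}$, the second hypothesis says $e_k\le\sqrt{l^3P}$ without a root, by optimizing
    [b]. It serves the scales $l\le P$ and the first one the scales $l>P$; both parts are geometric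
    sums dominated by $l\approx P$. *)
Lemma sum_levels_le {R : realType} (e : nat -> R) (P K : nat) :
  (forall k, (k < K)%N -> e k <= P%:R ^+ 2) ->
  (forall k b, (k < K)%N -> 0 < b -> 2 * e k <= (4 ^+ k.+2) ^+ 3 * P%:R / b + b) ->
  \sum_(k < K) e k / 4 ^+ k.+2 <= 6 * P%:R.
Proof.
move=> eA eB.
have [P0|P_gt0] := posnP P.
  rewrite P0 mulr0; apply: sumr_le0 => k _.
  by rewrite pmulr_lle0 ?invr_gt0 ?exprn_gt0// (le_trans (eA _ _))// P0 expr0n.
pose m := trunc_log 4 P; have /andP[mP Pm] := trunc_log_bounds (isT : (1 < 4)%N) P_gt0.
rewrite -/m in mP Pm.
have mP' : (4 ^+ m : R) <= P%:R by rewrite -natrX ler_nat.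
have Pm' : P%:R <= (4 ^+ m.+1 : R) by rewrite -natrX ler_nat ltnW.
have four n : (4 ^+ n : R) = 2 ^+ n * 2 ^+ n by rewrite -exprMn; congr (_ ^+ _); ring.
have term (k : 'I_K) : e k / 4 ^+ k.+2 <= ((k.+2 <= m) * 2 ^ k.+2)%N%:R * 2 ^+ m.+1
    + P%:R ^+ 2 * ((m < k.+2)%N%:R * 4 ^- k.+2).
  have k4 : (0 : R) < 4 ^+ k.+2 by rewrite exprn_gt0.
  have [km|km] := leqP k.+2 m; last first.
    by rewrite mul0n mul0r add0r mul1r ler_wpM2r ?eA// invr_ge0 ltW.
  rewrite mul0r mulr0 addr0 mul1n natrX ler_pdivrMr// four.
  set x := 2 ^+ k.+2; set y := 2 ^+ m.+1.
  have x0 : 0 < x by rewrite exprn_gt0.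
  have y0 : 0 < y by rewrite exprn_gt0.
  (* Here $l=x^2$ and $P\le y^2$, so $b=x^3y$ is about $\sqrt{l^3P}$, the optimal choice up to a
     factor 2. *)
  have b0 : 0 < x ^+ 3 * y by rewrite mulr_gt0// exprn_gt0.
  have := eB k _ (ltn_ord k) b0; rewrite four -/x.
  have : (x * x) ^+ 3 * P%:R / (x ^+ 3 * y) <= x ^+ 3 * y.
    rewrite ler_pdivrMr// (_ : (x * x) ^+ 3 = x ^+ 3 * x ^+ 3); last by ring.
    rewrite (_ : x ^+ 3 * y * _ = x ^+ 3 * x ^+ 3 * (y * y)); last by ring.
    rewrite ler_pM2l; [by rewrite -(four m.+1)|]; exact: mulr_gt0 (exprn_gt0 3 x0) (exprn_gt0 3 x0).
  by move=> h1 h2; have : x ^+ 3 * y = x * y * (x * x); [ring|lra].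
apply: le_trans (ler_sum _ (fun k _ => term k)) _.
rewrite big_split/= -mulr_suml -mulr_sumr -natr_sum.
have h1 : (\sum_(k < K) (k.+2 <= m) * 2 ^ k.+2)%N%:R <= (2 ^+ m.+1 : R).
  by rewrite -natrX ler_nat sum_pow2_trunc.
have h2 := @sum_inv_pow4_tail R K m.
have h3 : P%:R ^+ 2 * (4 / 3 * 4 ^- m.+1) <= 4 / 3 * P%:R :> R.
  rewrite mulrCA ler_wpM2l ?divr_ge0// expr2 -mulrA ler_piMr//.
  by rewrite ler_pdivrMr ?exprn_gt0// mul1r.
have h4 : (\sum_(k < K) (k.+2 <= m) * 2 ^ k.+2)%N%:R * 2 ^+ m.+1 <= 4 * P%:R :> R.
  apply: le_trans (ler_wpM2r _ h1) _; first by rewrite exprn_ge0.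
  by rewrite -four exprS ler_wpM2l.
have h5 := ler_wpM2l (sqr_ge0 (P%:R : R)) h2.
have P0 : 0 <= (P%:R : R) by [].
(* The two ranges give $4P$ and $\frac43P$, together below $6P$. *)
apply: le_trans (lerD h4 (le_trans h5 h3)) _; lra.
Qed.

(** * Signed tent functions *)

Lemma lipschitz_of_steps {R : realType} (h : nat -> R) :
  (forall i, `|h i.+1 - h i| <= 1) -> forall i j, `|h i - h j| <= `|i%:R - j%:R|.
Proof.
move=> h1 i j; wlog ij : i j / (i <= j)%N => [wl|].
  by have [/wl//|/ltnW/wl] := leqP i j; rewrite distrC [leRHS]distrC.
have steps k : `|h (i + k)%N - h i| <= k%:R.
  elim: k => [|k IHk]; first by rewrite addn0 subrr normr0.
  rewrite addnS -(subrK (h (i + k)%N) (h _)) -addrA -natr1 addrC.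
  by apply: le_trans (ler_normD _ _) _; exact: lerD.
rewrite distrC -{1}(subnKC ij); apply: le_trans (steps _) _.
by rewrite natrB// distrC ler_norm.
Qed.

Section Tent.
Context {R : realType}.
Variable a : nat.
Hypothesis a_gt0 : (0 < a)%N.

Definition dist_mult (i : nat) : nat := minn (i %% a) (a - i %% a).

(** The sup-norm distance to the boundaries of the cells of side [a]. *)
Definition tent (i j : nat) : nat := minn (dist_mult i) (dist_mult j).

Lemma tentC i j : tent i j = tent j i.
Proof. exact: minnC. Qed.

Definition signed_tent (s : nat -> nat -> nat) (i j : nat) : R :=
  (-1) ^+ s (i %/ a)%N (j %/ a)%N * (tent i j)%:R.

(** Inside a cell the sign is constant and the tent changes by at most 1. A step into a new cell
    ends on its boundary, where the tent vanishes, so arbitrary cell signs are allowed. *)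
Lemma signed_tent_stepl s i j : `|signed_tent s i.+1 j - signed_tent s i j| <= 1.
Proof.
rewrite /signed_tent divnS//; have [aSi|aSi] := boolP (a %| i.+1)%N.
  have -> : tent i.+1 j = 0%N by rewrite /tent /dist_mult modnS aSi !min0n.
  rewrite mulr0 sub0r normrN normrM normrX normrN1 expr1n mul1r normr_nat lern1.
  have : (tent i j <= dist_mult i)%N by exact: geq_minl.
  move=> h; apply: leq_trans h _; rewrite /dist_mult geq_min; apply/orP; right.
  have := ltn_pmod i a_gt0; move: aSi; rewrite /dvdn -addn1 -modnDml.
  have [lt|] := ltnP (i %% a + 1)%N a; first by rewrite modn_small//; lia.
  lia.
rewrite add0n -mulrBr normrM normrX normrN1 expr1n mul1r.
have : (dist_mult i.+1 <= (dist_mult i).+1)%N /\ (dist_mult i <= (dist_mult i.+1).+1)%N.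
  rewrite /dist_mult modnS (negPf aSi); have := ltn_pmod i a_gt0; lia.
rewrite /tent; move: (dist_mult i.+1) (dist_mult i) (dist_mult j) => x y z [h1 h2].
have [h3|h3] : (minn x z <= minn y z /\ minn y z <= (minn x z).+1 \/
  minn y z <= minn x z /\ minn x z <= (minn y z).+1)%N by lia.
  case: h3 => h4 h5; rewrite distrC -natrB// normr_nat lern1; lia.
by case: h3 => h4 h5; rewrite -natrB// normr_nat lern1; lia.
Qed.

Lemma signed_tent_lipschitz s i j i' j' :
  `|signed_tent s i j - signed_tent s i' j'| <= `|i%:R - i'%:R| + `|j%:R - j'%:R|.
Proof.
rewrite -(subrK (signed_tent s i' j) (signed_tent s i j)) -addrA.
apply: le_trans (ler_normD _ _) _; apply: lerD.
  by apply: (lipschitz_of_steps (signed_tent s ^~ j)) => k; exact: signed_tent_stepl.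
apply: (lipschitz_of_steps (signed_tent s i')) => k.
have := signed_tent_stepl (fun p q => s q p) k i'.
by rewrite /signed_tent !(tentC _ i').
Qed.

End Tent.

(** In cells of side $4b$ the tent is at least $b$ when both coordinates lie in the middle half of
    their period, which happens at a quarter of the points. *)
Lemma sum_tent (b Q : nat) : (0 < b)%N ->
  (b * (Q * (4 * b)) ^ 2 <= 4 * \sum_(i < Q * (4 * b)) \sum_(j < Q * (4 * b)) tent (4 * b) i j)%N.
Proof.
move=> b_gt0; set a := (4 * b)%N; set N := (Q * a)%N.
pose ind i : nat := (b <= i %% a)%N && (i %% a < 3 * b)%N.
have tent_ge i j : (b * (ind i * ind j) <= tent a i j)%N.
  have d_ge k : (b * ind k <= dist_mult a k)%N.
    rewrite /ind /dist_mult; case: andP => [[h1 h2]|_]; last by rewrite muln0.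
    by move: (k %% a)%N h1 h2 => r h1 h2; rewrite muln1 leq_min h1 /a; lia.
  have := d_ge i; have := d_ge j; rewrite /tent /ind.
  by do 2 case: andP => _; rewrite ?muln0 ?muln1 ?leq_min ?leq0n// => -> ->.
have sum_ind : (2 * \sum_(i < N) ind i = N)%N.
  rewrite (big_ord_blocks _ _ _ _ _ ind).
  have -> : (\sum_(q < Q) \sum_(i < a) ind (q * a + i) = \sum_(q < Q) 2 * b)%N.
    apply: eq_bigr => q _; rewrite (big_ord_blocks _ _ _ _ _ (fun i => ind (q * a + i)%N)).
    have mod_blk (r : nat) (i : 'I_b) : (r < 4)%N -> ((q * a + (r * b + i)) %% a = r * b + i)%N.
      by move=> r4; rewrite modnMDl modn_small// /a; have := ltn_ord i; nia.
    have blk (r : 'I_4) : (\sum_(i < b) ind (q * a + (r * b + i)) = (0 < r < 3) * b)%N.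
      transitivity (\sum_(i < b) (0 < r < 3))%N; last by rewrite sum_nat_const card_ord mulnC.
      apply: eq_bigr => i _.
      rewrite /ind mod_blk//; have := ltn_ord i; have := ltn_ord r.
      by move: (nat_of_ord r) => [|[|[|[|]]]]//=; lia.
    by rewrite !big_ord_recl big_ord0 !blk/=; lia.
  by rewrite sum_nat_const card_ord /N /a; lia.
have : (b * (\sum_(i < N) ind i) ^ 2 <= \sum_(i < N) \sum_(j < N) tent a i j)%N.
  rewrite -mulnn big_distrlr/= big_distrr/=; apply: leq_sum => i _.
  by rewrite big_distrr/=; apply: leq_sum => j _.
by move: sum_ind; set y := (\sum_(i < N) ind i)%N => <-; rewrite expnMn; lia.
Qed.

(** * Transportation cost norm: duality and recentering *)

Section TransportationCost.
Context {R : realType} {X : finType}.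
Variable d : X -> X -> R.
Hypothesis d_ge0 : forall x y, 0 <= d x y.
Implicit Types mu u : X -> R.

Lemma tc_norm_le mu s : tc_reps mu s ->
  tc_norm d mu <= \sum_(t <- s) t.1.1 * d t.1.2 t.2.
Proof.
move=> mus; apply: ge_inf; last by exists s.
exists 0 => _ [r [/allP r0 _] <-]; rewrite big_seq; apply: sumr_ge0 => t tr.
by rewrite mulr_ge0// r0.
Qed.

(** Weak Kantorovich duality. Some representation must exist, since the infimum of the empty set is
    a default value. *)
Lemma tc_norm_ge (g : X -> R) mu : tc_reps mu !=set0 ->
  (forall x y, g x - g y <= d x y) -> \sum_x g x * mu x <= tc_norm d mu.
Proof.
move=> [s0 s0mu] gd; apply: lb_le_inf; first by exists (\sum_(t <- s0) t.1.1 * d t.1.2 t.2), s0.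
move=> _ [s [/allP s_ge0 muE] <-].
have -> : \sum_x g x * mu x = \sum_(t <- s) t.1.1 * (g t.1.2 - g t.2).
  under eq_bigr do rewrite muE mulr_sumr.
  rewrite exchange_big/=; apply: eq_bigr => t _.
  under eq_bigr do rewrite mulrCA mulrBr.
  have ev (x : X) : \sum_z g z * (x == z)%:R = g x.
    rewrite (bigD1 x)//= eqxx mulr1 big1 ?addr0// => z zx.
    by rewrite eq_sym (negPf zx) mulr0.
  by rewrite -mulr_sumr sumrB !ev.
rewrite big_seq [leRHS]big_seq; apply: ler_sum => t ts.
by rewrite ler_wpM2l// s_ge0.
Qed.

Lemma tc_norm_dipole_le x y :
  tc_norm d (fun z => (x == z)%:R - (y == z)%:R) <= d x y.
Proof.
have := tc_norm_le (fun z => (x == z)%:R - (y == z)%:R) [:: (1, x, y)].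
rewrite big_seq1/= mul1r; apply; split; first by rewrite /= ler01.
by move=> z; rewrite big_seq1/= mul1r.
Qed.

(** Projects onto mass zero by compensating at [x0]. The averaging takes place in the group of all
    functions, while the embedding is controlled on zero-mass measures. *)
Definition recenter (x0 : X) (u : X -> R) (y : X) : R :=
  u y - (\sum_z u z) * (x0 == y)%:R.

Lemma sum_indic (x : X) : \sum_y (x == y)%:R = 1 :> R.
Proof.
by rewrite (bigD1 x)//= eqxx big1 ?addr0// => z zx; rewrite eq_sym (negPf zx).
Qed.

Lemma zero_mass_recenter x0 u : zero_mass (recenter x0 u).
Proof. by rewrite /zero_mass /recenter sumrB -mulr_sumr sum_indic mulr1 subrr. Qed.

(** Every mass is carried to or from [x0]; the orientation follows its sign so that the coefficients
    are nonnegative. *)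
Definition star_rep (x0 : X) u : seq (R * X * X) :=
  [seq (`|u x|, if 0 <= u x then x else x0, if 0 <= u x then x0 else x) | x <- enum X].

Lemma star_rep_recenter x0 u : tc_reps (recenter x0 u) (star_rep x0 u).
Proof.
split; first by apply/allP => _ /mapP[x _ ->] /=.
move=> z; rewrite big_map big_enum/= /recenter.
have -> : u z = \sum_x u x * (x == z)%:R.
  rewrite (bigD1 z)//= eqxx mulr1 big1 ?addr0// => x xz.
  by rewrite (negPf xz) mulr0.
rewrite mulr_suml -sumrB; apply: eq_bigr => x _.
by have [u0|/ltW u0] := leP 0 (u x); [rewrite ger0_norm//|rewrite ler0_norm//]; ring.
Qed.

Lemma tc_norm_recenter_le x0 u (delta : R) : (forall x y, d x y <= delta) ->
  tc_norm d (recenter x0 u) <= delta * \sum_x `|u x|.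
Proof.
move=> d_le; apply: le_trans (tc_norm_le _ _ (star_rep_recenter x0 u)) _.
rewrite big_map big_enum/= mulr_sumr; apply: ler_sum => x _.
by rewrite [leRHS]mulrC ler_wpM2l.
Qed.

End TransportationCost.

(** * The $\ell_1$ metric on the grid *)

Section GridDistance.
Context {R : realType} {n : nat}.

Lemma l1dist_ge0 (p q : grid n) : 0 <= l1dist R p q.
Proof. by rewrite /l1dist addr_ge0. Qed.

Lemma l1dist_le (p q : grid n) : l1dist R p q <= (2 * 2 ^ n)%:R.
Proof.
have h (i j : 'I_(2 ^ n).+1) : `|i%:R - j%:R| <= (2 ^ n)%:R :> R.
  have ni : (i%:R : R) <= (2 ^ n)%:R by rewrite ler_nat -ltnS.
  have nj : (j%:R : R) <= (2 ^ n)%:R by rewrite ler_nat -ltnS.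
  have i0 : 0 <= (i%:R : R) by []; have j0 : 0 <= (j%:R : R) by [].
  by rewrite ler_norml; apply/andP; split; lra.
by rewrite /l1dist mul2n -addnn natrD lerD.
Qed.

End GridDistance.

(** * Random Haar measures on dyadic blocks of the grid *)

Section GridFamily.
Context {R : realType} {n : nat}.
Let N := (2 ^ n)%N.
Let K := (n./2).-1.

(** One eighth of the block side $4^{k+2}$. The condition $k<K$ says exactly that this side is at
    most $2^n$. *)
Definition tent_width (k : nat) : nat := (2 ^ (2 * k).+1)%N.
Let a (k : nat) : nat := (4 * tent_width k)%N.
Let B (k : nat) : nat := (2 ^ (n - (2 * k).+4))%N.

Definition grid_point (i j : nat) : grid n := (inord i, inord j).

(** A scale and a sign pattern. Indexing patterns by grid points gives all scales the same type:
    block $(q,r)$ reads the sign at the point $(q,r)$. *)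
Definition sign_family : finType := ('I_K * {ffun grid n -> bool})%type.

(** The grid has $N+1$ points per side; the last row and column get 0 so that blocks tile the
    remaining $N\times N$ square. *)
Definition family_sign (i : sign_family) (x : grid n) : int :=
  if (x.1 < N)%N && (x.2 < N)%N
  then (-1) ^+ i.2 (grid_point (x.1 %/ (2 * a i.1)) (x.2 %/ (2 * a i.1)))
       * (-1) ^+ (x.1 %/ a i.1)
  else 0.

(** The inverse block side times the probability of one sign pattern. *)
Definition family_weight (i : sign_family) : R :=
  (4 ^+ i.1.+2)^-1 * #|{ffun grid n -> bool}|%:R^-1.

Definition grid_edges : seq (grid n * grid n) :=
  [seq (grid_point q.1.+1 q.2, grid_point q.1 q.2) | q : 'I_N * 'I_N] ++
  [seq (grid_point q.1 q.2.+1, grid_point q.1 q.2) | q : 'I_N * 'I_N].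

Let a_gt0 k : (0 < a k)%N. Proof. by rewrite muln_gt0 expn_gt0. Qed.

Let NE k : (k < K)%N -> N = (B k * (2 * a k))%N.
Proof.
move=> kK.
rewrite /N /B /a /tent_width (_ : 2 * (4 * _) = 2 ^ (2 * k).+4)%N; last by rewrite !expnS; lia.
rewrite -expnD subnK//; move: kK; rewrite /K.
have := odd_double_half n; move: (n./2) (odd n) => h o <-; case: o => /=; lia.
Qed.

Let lE k : (2 * a k)%N%:R = 4 ^+ k.+2 :> R.
Proof.
rewrite -natrX /a /tent_width; congr (_%:R).
by rewrite expnS expnM -[(2 ^ 2)%N]/4%N !(expnS 4); lia.
Qed.

Lemma size_grid_edges : size grid_edges = (2 * N ^ 2)%N.
Proof.
by rewrite size_cat !size_image card_prod !card_ord mulnn mul2n addnn.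
Qed.

Lemma grid_point_val (x : grid n) : grid_point x.1 x.2 = x.
Proof. by case: x => i j; rewrite /grid_point !inord_val. Qed.

Lemma sum_grid_edges (f : grid n * grid n -> R) : \sum_(p <- grid_edges) f p =
  \sum_(i < N) \sum_(j < N) (f (grid_point i.+1 j, grid_point i j)
                             + f (grid_point i j.+1, grid_point i j)).
Proof.
rewrite big_cat/= !big_image/= -big_split/=.
by rewrite -(pair_bigA _ (fun i j : 'I_N => f (grid_point i.+1 j, grid_point i j)
                                            + f (grid_point i j.+1, grid_point i j))).
Qed.

Lemma l1dist_edge p : p \in grid_edges -> l1dist R p.1 p.2 <= 1.
Proof.
have val_le i : (i <= N)%N -> (inord i : 'I_N.+1) = i :> nat by move=> iN; rewrite inordK.
rewrite mem_cat => /orP[] /mapP[[i j] _ ->]; rewrite /l1dist /= !val_le ?(ltnW (ltn_ord _))//.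
  by rewrite subrr normr0 addr0 -natr1 addrAC subrr add0r normr1.
by rewrite subrr normr0 add0r -natr1 addrAC subrr add0r normr1.
Qed.

Lemma sum_family_sign i (f : grid n -> R) :
  \sum_x (family_sign i x)%:~R * f x =
  sign_pairing (a i.1) (B i.1) (fun q r => i.2 (grid_point q r)) (fun x y => f (grid_point x y)).
Proof.
rewrite /sign_pairing -(NE _ (ltn_ord i.1)).
pose s (x y : nat) : R := (-1) ^+ i.2 (grid_point (x %/ (2 * a i.1)) (y %/ (2 * a i.1)))
  * (-1) ^+ (x %/ a i.1).
pose h x y := (if (x < N)%N && (y < N)%N then s x y else 0) * f (grid_point x y).
transitivity (\sum_(x < N.+1) \sum_(y < N.+1) h x y).
  rewrite pair_bigA/=; apply: eq_bigr => x _; rewrite /h grid_point_val; congr (_ * _).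
  rewrite /family_sign; case: ifP => // _.
  by rewrite rmorphM !rmorphXn/= rmorphN1.
rewrite big_ord_recr/= [X in _ + X]big1 ?addr0 => [|y _]; last by rewrite /h ltnn mul0r.
apply: eq_bigr => x _; rewrite big_ord_recr/= /h ltnn andbF mul0r addr0.
by apply: eq_bigr => y _; rewrite !ltn_ord.
Qed.

Lemma sum_family_sign_cst i (c : R) : \sum_x (family_sign i x)%:~R * c = 0.
Proof.
rewrite sum_family_sign sign_pairingE//; apply: big1 => q _; apply: big1 => r _.
by rewrite haar_cst ?mulr0.
Qed.

Lemma family_sign_le1 i x : `|family_sign i x| <= 1.
Proof.
rewrite /family_sign; case: ifP => _; last by rewrite normr0.
by rewrite normrM !normrX normrN1 !expr1n.
Qed.

Lemma grid_point_inj k q r q' r' : (q < B k)%N -> (r < B k)%N -> (q' < B k)%N -> (r' < B k)%N ->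
  grid_point q r = grid_point q' r' -> q = q' /\ r = r'.
Proof.
have BN x : (x < B k -> x < N.+1)%N.
  by move=> xB; rewrite ltnS ltnW// (leq_trans xB)// leq_pexp2l// leq_subr.
move=> /BN hq /BN hr /BN hq' /BN hr' [] /(congr1 (@nat_of_ord _)) h1 /(congr1 (@nat_of_ord _)).
by move: h1; rewrite !inordK.
Qed.

(* Discrete analogue of the planar Hardy-type inequality
   sum_k |f^(k)| / |k| <= C ||grad f||_1. *)
Lemma grid_functional_ineq (f : grid n -> R) :
  \sum_i family_weight i * `|\sum_x (family_sign i x)%:~R * f x|
  <= 6 * \sum_(p <- grid_edges) `|f p.1 - f p.2|.
Proof.
have w0 i : 0 <= family_weight i by rewrite mulr_ge0// invr_ge0 ?exprn_ge0.
apply: (@coarea_le _ _ _ (fun f => \sum_i family_weight i *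
    `|\sum_x (family_sign i x)%:~R * f x|)) => //.
- move=> g h; rewrite -big_split/=; apply: ler_sum => i _; rewrite -mulrDr ler_wpM2l//.
  by under eq_bigr do rewrite mulrDr; rewrite big_split/=; exact: ler_normD.
- move=> t g t0; rewrite mulr_sumr; apply: ler_sum => i _; rewrite mulrCA ler_wpM2l//.
  under eq_bigr do rewrite mulrCA.
  by rewrite -mulr_sumr normrM ger0_norm.
- by move=> t; rewrite big1// => i _; rewrite sum_family_sign_cst normr0 mulr0.
move=> S; pose S' i j := S (grid_point i j).
have -> : \sum_(p <- grid_edges) `|(S p.1)%:R - (S p.2)%:R| = (perim N S')%:R :> R.
  rewrite (sum_grid_edges (fun p => `|(S p.1)%:R - (S p.2)%:R|)) /perim natr_sum.
  apply: eq_bigr => i _; rewrite natr_sum; apply: eq_bigr => j _.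
  have indic (b c : bool) : `|b%:R - c%:R| = (b != c)%:R :> R.
    by case: b c => [] []; rewrite ?subrr ?normr0 ?subr0 ?sub0r ?normrN1 ?normr1.
  by rewrite natrD !indic.
set A := #|{ffun grid n -> bool}|.
have A0 : 0 < A%:R :> R by rewrite ltr0n; apply/card_gt0P; exists [ffun=> false].
pose pairing k eps := sign_pairing (a k) (B k) (fun q r => eps (grid_point q r))
  (fun x y => (S' x y)%:R) : R.
pose e k : R := A%:R^-1 * \sum_(eps : {ffun grid n -> bool}) `|pairing k eps|.
have -> : \sum_i family_weight i * `|\sum_x (family_sign i x)%:~R * (S x)%:R|
    = \sum_(k < K) e k / 4 ^+ k.+2.
  rewrite -(pair_bigA _ (fun (k : 'I_K) eps => family_weight (k, eps) *
     `|\sum_x (family_sign (k, eps) x)%:~R * (S x)%:R|))/=.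
  apply: eq_bigr => k _; rewrite /e mulrC mulrA mulr_sumr; apply: eq_bigr => eps _.
  by rewrite sum_family_sign.
apply: sum_levels_le => [k kK|k b kK b0].
  rewrite ler_pdivrMl// mulr_natl /A -sumr_const; apply: ler_sum => eps _.
  rewrite (NE k kK).
  exact: (sign_pairing_indic_le _ _ (a_gt0 k) (fun q r => eps (grid_point q r))).
have second : \sum_(eps : {ffun grid n -> bool}) pairing k eps ^+ 2
    <= A%:R * ((4 ^+ k.+2) ^+ 3 * (perim N S')%:R).
  have := @sign_pairing_indic_sqr R (a k) (B k) (a_gt0 k) _ grid_point S' (@grid_point_inj k).
  by rewrite lE -(NE k kK).
set Q := (4 ^+ k.+2) ^+ 3 * _ in second *.
(* This passes from the second moment over the signs to the first, in the root-free form expected by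
   [sum_levels_le]. *)
have amgm (z : R) : 2 * `|z| <= z ^+ 2 / b + b.
  have : 0 <= (`|z| - b) ^+ 2 / b by rewrite divr_ge0 ?sqr_ge0 ?ltW.
  rewrite -[z ^+ 2]real_normK ?num_real// (_ : _ / b = `|z| ^+ 2 / b + b - 2 * `|z|).
    by lra.
  by field; rewrite gt_eqF.
rewrite /e mulrCA ler_pdivrMl// mulr_sumr mulrDr.
apply: le_trans (ler_sum _ (fun eps _ => amgm _)) _.
rewrite big_split/= -mulr_suml sumr_const [A%:R * b]mulr_natl lerD2r.
by rewrite mulrA ler_wpM2r// invr_ge0 ltW.
Qed.

(** The cell signs of the tent copy the Haar and block signs; a block is two cells wide, hence the
    halved indices. *)
Definition family_dual (i : sign_family) (x : grid n) : R :=
  signed_tent (a i.1) (fun p q => i.2 (grid_point (p %/ 2) (q %/ 2)) + p)%N x.1 x.2.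

Lemma family_dual_lipschitz (i : sign_family) x y :
  family_dual i x - family_dual i y <= l1dist R x y.
Proof. exact: le_trans (ler_norm _) (signed_tent_lipschitz _ (a_gt0 _) _ _ _ _ _). Qed.

(** Equal signs cancel, leaving the full sum of the tent. With [tent_width] equal to $l/8$,
    [sum_tent] bounds it below by $N^2l/32$. *)
Lemma family_dual_pairing (i : sign_family) :
  N%:R ^+ 2 * 4 ^+ i.1.+2 / 32 <= \sum_x (family_sign i x)%:~R * family_dual i x.
Proof.
rewrite sum_family_sign /sign_pairing -(NE _ (ltn_ord i.1)).
have -> : \sum_(x < N) \sum_(y < N) (-1) ^+ i.2 (grid_point (x %/ (2 * a i.1)) (y %/ (2 * a i.1)))
    * (-1) ^+ (x %/ a i.1) * family_dual i (grid_point x y)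
  = (\sum_(x < N) \sum_(y < N) tent (a i.1) x y)%:R.
  rewrite natr_sum; apply: eq_bigr => x _; rewrite natr_sum; apply: eq_bigr => y _.
  rewrite /family_dual /signed_tent /= !inordK ?ltnS 1?ltnW//.
  rewrite ![in X in X * _](mulnC 2) !divnMA exprD mulrA mulrACA -!expr2.
  by rewrite !sqrr_sign ?mul1r// -exprM mulnC exprM sqrrN !expr1n !mul1r.
have := sum_tent (tent_width i.1) (B i.1 * 2) _.
rewrite -mulnA -(NE _ (ltn_ord i.1)) expn_gt0 => /(_ isT).
rewrite -(ler_nat R) !natrM natrX -lE /a; set t := (\sum_(x < N) _)%N.
by rewrite !natrM /tent_width natrX; lra.
Qed.

End GridFamily.

Lemma recenter_zero_mass {R : realType} {X : finType} (x0 : X) (u : X -> R) :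
  zero_mass u -> recenter x0 u = u.
Proof. by move=> u0; apply/funext => y; rewrite /recenter u0 mul0r subr0. Qed.

Lemma recenterB {R : realType} {X : finType} (x0 : X) (u v : X -> R) :
  recenter x0 u \- recenter x0 v = recenter x0 (fun y => u y - v y).
Proof. by apply/funext => y; rewrite /= /recenter sumrB; ring. Qed.

(** * Integer combinations of Dirac masses *)

Section DeltaBasis.
Context {R : realType} {X : finType}.

Definition dirac_ffun (x : X) : {ffun X -> R} := [ffun y => (x == y)%:R].

Lemma ffunMzE (u : {ffun X -> R}) (z : int) y : (u *~ z) y = u y * z%:~R.
Proof.
case: z => k; first by rewrite -pmulrn ffunMnE mulr_natr.
by rewrite NegzE mulrNz -pmulrn mulrNz -pmulrn ffunE ffunMnE mulrN mulr_natr.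
Qed.

Lemma sum_dirac_ffun (s : seq X) (z : X -> int) y :
  (\sum_(x <- s) dirac_ffun x *~ z x) y = \sum_(x <- s) (x == y)%:R * (z x)%:~R.
Proof. by rewrite sum_ffunE; apply: eq_bigr => x _; rewrite ffunMzE ffunE. Qed.

Lemma sum_enum_dirac_ffun (z : X -> int) y :
  (\sum_(x <- enum X) dirac_ffun x *~ z x) y = (z y)%:~R.
Proof.
rewrite sum_dirac_ffun big_enum/= (bigD1 y)//= eqxx mul1r big1 ?addr0// => x xy.
by rewrite (negPf xy) mul0r.
Qed.

Lemma norm_sum_dirac_ffun_le (s : seq X) (z : X -> int) y :
  uniq s -> (forall x, `|z x| <= 1) -> `|(\sum_(x <- s) dirac_ffun x *~ z x) y| <= 1.
Proof.
move=> us z1; rewrite sum_dirac_ffun.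
have z1R x : `|(z x)%:~R : R| <= 1 by rewrite -intr_norm -[leRHS]/(1%:~R) ler_int.
have off r : y \notin r -> \sum_(x <- r) (x == y)%:R * (z x)%:~R = 0 :> R.
  move=> yr; rewrite big_seq big1// => x xr.
  by have [xy|_] := eqVneq x y; [rewrite -xy xr in yr|rewrite mul0r].
have [ys|/off ->] := boolP (y \in s); last by rewrite normr0.
rewrite (perm_big _ (perm_to_rem ys)) big_cons/= eqxx mul1r off ?addr0//.
by rewrite mem_rem_uniq// inE eqxx.
Qed.

End DeltaBasis.

(** * Distortion of an embedding of the transportation cost space *)

Section EmbeddedGrid.
Context {R : realType} {n : nat}.
Variable D : R.
Context {disp : measure_display} {T : measurableType disp}.
Variables (m : {measure set T -> \bar R}) (F : (grid n -> R) -> T -> R).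
Hypothesis F_integ : forall mu, zero_mass mu -> integ m (F mu).
Hypothesis F_lower : forall mu nu, zero_mass mu -> zero_mass nu ->
  tc_norm (@l1dist R n) (mu \- nu) <= nrm1 m (fun t => F mu t - F nu t).
Hypothesis F_upper : forall mu nu, zero_mass mu -> zero_mass nu ->
  nrm1 m (fun t => F mu t - F nu t) <= D * tc_norm (@l1dist R n) (mu \- nu).

Let x0 : grid n := (ord0, ord0).
Let zero_massA (u : grid n -> R) : zero_mass (recenter x0 u) := zero_mass_recenter x0 u.

(** The two Lipschitz bounds are compared on one dipole between corners, whose norm is positive
    because the first coordinate is 1-Lipschitz. *)
Lemma distortion_ge1 : 1 <= D.
Proof.
pose x1 : grid n := (ord_max, ord0).
pose u (y : grid n) : R := (x1 == y)%:R.
have := le_trans (F_lower _ _ (zero_massA u) (zero_massA (fun=> 0)))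
                 (F_upper _ _ (zero_massA u) (zero_massA (fun=> 0))).
set v := recenter x0 u \- _; suff v0 : 0 < tc_norm (@l1dist R n) v.
  by rewrite ler_pMl.
have rep : tc_reps v !=set0 by rewrite /v recenterB; eexists; exact: star_rep_recenter.
apply: lt_le_trans (tc_norm_ge _ (fun x : grid n => (x.1 : nat)%:R) _ rep _); last first.
  by move=> x y; apply: le_trans (ler_norm _) _; rewrite lerDl.
have -> : v = fun y => (x1 == y)%:R - (x0 == y)%:R.
  apply/funext => y; rewrite /v /recenter /= /u sum_indic big1// mul0r mul1r.
  by rewrite subrr subr0.
have ev (x : grid n) : \sum_(y : grid n) (y.1 : nat)%:R * (x == y)%:R = (x.1 : nat)%:R :> R.
  rewrite (bigD1 x)//= eqxx mulr1 big1 ?addr0// => z zx.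
  by rewrite eq_sym (negPf zx) mulr0.
under eq_bigr do rewrite mulrBr.
by rewrite sumrB !ev/= subr0 ltr0n expn_gt0.
Qed.

Let N := (2 ^ n)%N.

(** The transfer theorem is applied to the Dirac masses, the signs of $\mu_\varepsilon$ and the grid
    edges, with constant 6 from the functional inequality. *)
Lemma distortion_lower_bound : (n./2).-1%:R / 384 <= D.
Proof.
have D_ge1 := distortion_ge1; have D_ge0 : 0 <= D by exact: le_trans D_ge1.
pose V : zmodType := {ffun grid n -> R}.
pose H (u : V) := F (recenter x0 u).
pose omega (u : V) := D * tc_norm (@l1dist R n) (recenter x0 u).
pose delta : R := (2 * N)%:R.
have omega_le (u : V) (c : R) : \sum_y `|u y| <= c -> omega u <= D * delta * c.
  move=> uc; rewrite /omega -mulrA ler_wpM2l//.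
  apply: le_trans (tc_norm_recenter_le _ l1dist_ge0 _ _ _ l1dist_le) _.
  by rewrite ler_wpM2l.
have HB (u v : V) : recenter x0 u \- recenter x0 v = recenter x0 (u - v : V).
  by rewrite recenterB; congr recenter; apply/funext => y; rewrite !ffunE.
have mu_zero (i : sign_family) : zero_mass (fun y : grid n => (family_sign i y)%:~R : R).
  have := @sum_family_sign_cst R n i 1; rewrite /zero_mass.
  by under eq_bigr do rewrite mulr1.
pose L (i : @sign_family n) : R := N%:R ^+ 2 * 4 ^+ i.1.+2 / 32.
have := @functional_ineq_transfer R disp T m V (grid n) (@sign_family n) dirac_ffun H omega
  (D * delta) (D * delta * #|grid n|%:R) D 6 family_weight L family_sign grid_edges.
rewrite size_grid_edges.
(* The weight cancels the side length, so each scale contributes $N^2/32$. *)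
have -> : \sum_i family_weight i * L i = (n./2).-1%:R * (N%:R ^+ 2 / 32).
  pose A := #|{ffun grid n -> bool}|.
  have A0 : A%:R != 0 :> R by rewrite pnatr_eq0 -lt0n; apply/card_gt0P; exists [ffun=> false].
  have w (i : @sign_family n) : family_weight i * L i = A%:R^-1 * (N%:R ^+ 2 / 32).
    rewrite /family_weight /L -/A; field.
    by rewrite A0 expf_neq0.
  under eq_bigr do rewrite w.
  rewrite sumr_const card_prod card_ord -/A -[LHS]mulr_natl natrM -mulrA; congr (_ * _).
  by rewrite mulVKf.
move=> transfer.
(* There are $2N^2$ edges, whence $384=32\cdot6\cdot2$. *)
suff : (n./2).-1%:R * (N%:R ^+ 2 / 32) <= 6 * (D * (2 * N ^ 2)%N%:R).
  have N0 : 0 < N%:R ^+ 2 :> R by rewrite exprn_gt0// ltr0n expn_gt0.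
  rewrite natrM natrX => h.
  rewrite -(ler_pM2r N0); lra.
apply: transfer.
- by move=> u; exact: F_integ.
- move=> u v; apply: le_trans (F_upper _ _ (zero_massA _) (zero_massA _)) _.
  by rewrite HB addrC addKr.
- by rewrite mulr_ge0.
- move=> x i; apply: omega_le; under eq_bigr do rewrite ffunMnE ffunE normrMn normr_nat.
  by rewrite sumrMnl sum_indic.
- exact: family_sign_le1.
- move=> i s us; apply: omega_le; rewrite -[#|_|]sum1_card natr_sum.
  by apply: ler_sum => y _; apply: norm_sum_dirac_ffun_le => // x; exact: family_sign_le1.
- by move=> i; rewrite mulr_ge0// invr_ge0 ?exprn_ge0.
(* The measure has mass zero, so recentering fixes it, and the dual tent bounds its norm from
   below. *)
- move=> i u j; apply: le_trans (F_lower _ _ (zero_massA _) (zero_massA _)).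
  rewrite HB addrC addKr; set v : V := _ *+ j.
  have vE : recenter x0 v = fun y => (family_sign i y)%:~R *+ j.
    have -> : (v : grid n -> R) = fun y => (family_sign i y)%:~R *+ j.
      by apply/funext => y; rewrite /v ffunMnE sum_enum_dirac_ffun.
    by apply: recenter_zero_mass; rewrite /zero_mass sumrMnl (mu_zero i) mul0rn.
  have rep : tc_reps (recenter x0 v) !=set0 by eexists; exact: star_rep_recenter.
  apply: le_trans (tc_norm_ge _ (family_dual i) _ rep (family_dual_lipschitz i)).
  rewrite vE; under eq_bigr do rewrite mulrC -mulr_natl -mulrA.
  by rewrite -mulr_sumr ler_wpM2l// family_dual_pairing.
- move=> u p pE; apply: le_trans (F_upper _ _ (zero_massA _) (zero_massA _)) _.
  rewrite HB opprD addrACA subrr add0r ler_piMr//.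
  apply: le_trans (l1dist_edge _ pE).
  rewrite (_ : recenter x0 _ = fun z => (p.1 == z)%:R - (p.2 == z)%:R).
    by apply: tc_norm_dipole_le; exact: l1dist_ge0.
  rewrite (_ : (dirac_ffun _ - _ : grid n -> R) = fun z => (p.1 == z)%:R - (p.2 == z)%:R).
    by apply: recenter_zero_mass; rewrite /zero_mass sumrB !sum_indic subrr.
  by apply/funext => z; rewrite !ffunE.
- by [].
- exact: grid_functional_ineq.
Qed.

End EmbeddedGrid.

(* c_1(TC(Gr_n)) >= (n-1)/5760: every D for which some map F of TC(Gr_n)
   into some L_1(m) satisfies
   ||mu-nu||_TC <= ||F mu - F nu||_1 <= D ||mu-nu||_TC  is >= (n-1)/5760. *)
Theorem theorem3p9 (R : realType) (n : nat) (hn : (2 <= n)%N) (D : R)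
  (disp : measure_display) (T : measurableType disp)
  (m : {measure set T -> \bar R})
  (F : (grid n -> R) -> T -> R) :
  (forall mu : grid n -> R, zero_mass mu -> m.-integrable setT (EFin \o F mu)) ->
  (forall mu nu : grid n -> R, zero_mass mu -> zero_mass nu ->
     ((tc_norm (@l1dist R n) (mu \- nu))%:E
        <= \int[m]_x (`|F mu x - F nu x|)%:E)%E /\
     (\int[m]_x (`|F mu x - F nu x|)%:E
        <= (D * tc_norm (@l1dist R n) (mu \- nu))%:E)%E) ->
  (n - 1)%:R / 5760 <= D.
Proof.
move=> F_integ F_bilip.
have nrmE mu nu : zero_mass mu -> zero_mass nu ->
    (nrm1 m (fun t => F mu t - F nu t))%:E = (\int[m]_x (`|F mu x - F nu x|)%:E)%E.
  by move=> mu0 nu0; apply: nrm1E; apply: integB; exact: F_integ.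
have F_lower mu nu : zero_mass mu -> zero_mass nu ->
    tc_norm (@l1dist R n) (mu \- nu) <= nrm1 m (fun t => F mu t - F nu t).
  by move=> mu0 nu0; rewrite -lee_fin nrmE//; case: (F_bilip mu nu mu0 nu0).
have F_upper mu nu : zero_mass mu -> zero_mass nu ->
    nrm1 m (fun t => F mu t - F nu t) <= D * tc_norm (@l1dist R n) (mu \- nu).
  by move=> mu0 nu0; rewrite -lee_fin nrmE//; case: (F_bilip mu nu mu0 nu0).
have D_ge1 := distortion_ge1 _ _ _ F_lower F_upper.
have D_ge := distortion_lower_bound _ _ _ F_integ F_lower F_upper.
(* For $n\le3$ there is no scale, and $D\ge1$ suffices. *)
have [n3|n4] := leqP n 3.
  have : (n - 1)%:R <= 2 :> R by rewrite ler_nat; lia.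
  lra.
(* With $K\ge1$ scales, $n-1\le2K+2\le4K\le1536D$. *)
have [p1 np] : (1 <= (n./2).-1 /\ n - 1 <= 2 * (n./2).-1 + 2)%N.
  have := odd_double_half n; move: (n./2) (odd n) => h o nE; move: n4; rewrite -nE -muln2.
  by case: o {nE}; lia.
have p1R : 1 <= (n./2).-1%:R :> R by rewrite ler1n.
have npR : (n - 1)%:R <= 2 * (n./2).-1%:R + 2 :> R by rewrite -natrM -natrD ler_nat.
lra.
Qed.
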